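(* Let $d\in\{0,1,\dots,n+1\}$ and $\epsilon,\tilde\epsilon\in\mathbb{Z}_2^{n+1}$ with $|\epsilon|=|\tilde\epsilon|=d$. Assume $q,\tilde q$ have positive real entries and $V$ is real. Then $$\mathcal{P}_{\bar1}(\epsilon,\tilde\epsilon)=\frac{q_0^{d/2}}{d!}\sum_{|I|=|J|=d}q_I^{-\frac12}\,\tilde q_J^{-\frac12}\,\phi_d(\sigma_I^{-1}g_V\sigma_J)\,\tilde\epsilon_I\,\epsilon_J,$$ where $I,J$ range over the size-$d$ subsets of $\{0,\dots,n\}$ and $\phi_d$ is the spherical function associated with the oriented Grassmannian $\widetilde{Gr}(n+1,d)=SO(n+1)/(SO(d)\times SO(n+1-d))$.
   Context: Let $n\in\mathbb{Z}_{\ge0}$ and $\Lambda=(q,\tilde q,V)$ with $q,\tilde q$ tuples of length $n+1$ and $V=(v_{i,j})_{i,j=0}^n$ such that $q_0=\tilde q_0\ne0$, $v_{0,j}=v_{i,0}=1$ for all $i,j$, and $QV\tilde QV^{\mathsf t}=q_0I_{n+1}$, where $Q=\mathrm{diag}(q)$, $\tilde Q=\mathrm{diag}(\tilde q)$. Here $\mathbb{Z}_2=\{0,1\}$, $|\epsilon|=\sum_i\epsilon_i$, and $a_I=\prod_{i\in I}a_i$ for a tuple $a$ and index set $I$. Odd Krawtchouk polynomials: with $\xi_0,\dots,\xi_n$ anticommuting variables and $\xi^\epsilon=\xi_0^{\epsilon_0}\cdots\xi_n^{\epsilon_n}$, $\mathcal{P}_{\bar1}(\epsilon,\tilde\epsilon)$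 is defined for $|\epsilon|=|\tilde\epsilon|=d$ by $\prod_{i=0}^n\big(\sum_{j=0}^nv_{i,j}\xi_j\big)^{\tilde\epsilon_i}=\sum_{|\epsilon|=d}d!\,\mathcal{P}_{\bar1}(\epsilon,\tilde\epsilon)\,\xi^\epsilon$ (product in increasing order of $i$). Spherical function: let $\xi_0,\dots,\xi_n$ be the standard orthonormal basis of $\mathcal{W}_{\mathbb{R}}=\mathbb{R}^{n+1}$; $G=SO(n+1)$ acts on $\bigwedge^d\mathcal{W}_{\mathbb{R}}$ by $g.(u_0\wedge\cdots\wedge u_{d-1})=gu_0\wedge\cdots\wedge gu_{d-1}$, and $(\cdot,\cdot)$ is the inner product on $\bigwedge^d\mathcal{W}_{\mathbb{R}}$ induced from the standard one (so the $\xi_I=\xi_{i_0}\wedge\cdots\wedge\xi_{i_{d-1}}$, $I=\{i_0<\dots<i_{d-1}\}$, are orthonormal). Let $v^K=\xi_0\wedge\cdots\wedge\xi_{d-1}$, a vector fixed by $K=SO(d)\times SO(n+1-d)$, and $\phi_d(g)=(v^K,g.v^K)$ for $g\in G$. For each $I$ of size $d$, $\sigma_I\in G$ is any element with $\sigma_I.v^K=\xi_I$. The matrix $g_V=q_0^{-1/2}Q^{1/2}V\tilde Q^{1/2}\in O(n+1)$, where $Q^{1/2}$, $\tilde Q^{1/2}$ are real diagonal square roots of $Q,\tilde Q$ whose signs are chosen so that $\det g_V=1$ (so $g_V\in SO(n+1)$), and $q_0^{1/2}$ (in $q_0^{-1/2}$ and $q_0^{d/2}$) is the positive square root. $q_I^{-1/2}$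 and $\tilde q_J^{-1/2}$ denote the products of the inverses of the corresponding diagonal entries of the chosen $Q^{1/2}$ and $\tilde Q^{1/2}$. The formula is independent of these choices and of the choices of $\sigma_I,\sigma_J$. *)

(* Defs.v *)
From HB Require Import structures.
From mathcomp Require Import all_boot all_order all_algebra.
From mathcomp Require Import ring.
From mathcomp Require Import reals.

Set Implicit Arguments.
Unset Strict Implicit.
Unset Printing Implicit Defensive.

Import Order.TTheory GRing.Theory Num.Theory.
Local Open Scope ring_scope.

(* The exterior algebra on anticommuting variables xi_0, ..., xi_(m-1).       *)
(* The entry of w at the subset I of 'I_m is the coefficient of the basis     *)
(* monomial xi_I = \prod_(i in I) xi_i (increasing order); see xiIE.          *)
Definition exterior (R : comNzRingType) (m : nat) := {ffun {set 'I_m} -> R^o}.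

HB.instance Definition _ (R : comNzRingType) m :=
  GRing.Lmodule.on (exterior R m).

Section ExteriorAlgebra.
Variables (R : comNzRingType) (m : nat).
Local Notation E := (exterior R m).
Implicit Types (I J K L : {set 'I_m}) (a b c w : E).

Definition inversions I J : nat := \sum_(i in I) \sum_(j in J) (j < i)%N.

Definition ext_mul a b : E :=
  [ffun K : {set 'I_m} => \sum_(I : {set 'I_m} | I \subset K)
     (-1) ^+ inversions I (K :\: I) * (a I * b (K :\: I))].

Definition ext_one : E := [ffun K : {set 'I_m} => (K == set0)%:R].

Lemma inversions0l J : inversions set0 J = 0%N.
Proof. by rewrite /inversions big_set0. Qed.

Lemma inversions0r I : inversions I set0 = 0%N.
Proof. by rewrite /inversions big1 // => i _; rewrite big_set0. Qed.

Lemma inversionsUl I J K : [disjoint I & J] ->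
  inversions (I :|: J) K = (inversions I K + inversions J K)%N.
Proof. move=> dIJ; rewrite /inversions -bigU //=; apply: eq_bigl => i.
by rewrite !inE. Qed.

Lemma inversionsUr I J K : [disjoint J & K] ->
  inversions I (J :|: K) = (inversions I J + inversions I K)%N.
Proof.
move=> dJK; rewrite /inversions -big_split; apply: eq_bigr => i _ /=.
by rewrite -bigU //=; apply: eq_bigl => j; rewrite !inE.
Qed.

Lemma ext_mulA : associative ext_mul.
Proof.
move=> a b c; apply/ffunP => K; rewrite !ffunE.
under eq_bigr => I _ do rewrite ffunE !mulr_sumr.
under [RHS]eq_bigr => L _ do rewrite ffunE mulr_suml mulr_sumr.
rewrite [RHS](exchange_big_dep (fun I : {set 'I_m} => I \subset K)) /=; last first.
  by move=> L I LK IL; apply: subset_trans IL LK.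
apply: eq_bigr => I IK.
rewrite [RHS](reindex_onto (fun J => I :|: J) (fun L => L :\: I)) /=; last first.
  move=> L /andP[_ IL]; apply/setP => x; rewrite !inE.
  by have := subsetP IL x; case: (x \in I) => //= ->.
apply: eq_big => [J|J JKI].
  rewrite subUset IK subsetUl /= andbT.
  rewrite subsetD setDUl setDv set0U; congr (_ && _).
  exact/setDidPl/eqP.
have [JK dJI] : J \subset K /\ [disjoint I & J].
  by move: JKI; rewrite subsetD => /andP[-> ]; rewrite disjoint_sym.
have -> : (I :|: J) :\: I = J.
  by rewrite setDUl setDv set0U; apply/setDidPl; rewrite disjoint_sym.
have eD : (K :\: I) :\: J = K :\: (I :|: J) by rewrite setDDl.
have eU : K :\: I = J :|: (K :\: (I :|: J)).
  apply/setP => x; rewrite !inE; have := subsetP JKI x; rewrite !inE.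
  by case: (x \in J) => //= [->//|_]; rewrite orbF.
rewrite eD {1}eU inversionsUr; last first.
  by rewrite -setI_eq0; apply/eqP/setP => x; rewrite !inE; case: (x \in J); rewrite ?orbT ?andbF.
have shuffle (s1 s2 s3 x y z : R) :
    s1 * s2 * (x * (s3 * (y * z))) = s2 * s3 * (s1 * (x * y) * z) by ring.
by rewrite inversionsUl // !exprD; apply: shuffle.
Qed.

Lemma ext_mul1w : left_id ext_one ext_mul.
Proof.
move=> w; apply/ffunP => K; rewrite ffunE (bigD1 set0) ?sub0set //=.
rewrite big1 => [|I /andP[_ /negPf I0]]; last by rewrite ffunE I0 mul0r mulr0.
by rewrite ffunE eqxx setD0 inversions0l addr0 !mul1r.
Qed.

Lemma ext_mulw1 : right_id ext_one ext_mul.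
Proof.
move=> w; apply/ffunP => K; rewrite ffunE (bigD1 K) //=.
rewrite big1 => [|I /andP[IK neqIK]]; last first.
  rewrite ffunE (_ : (K :\: I == set0) = false) ?mulr0 //.
  by rewrite setD_eq0; apply: contraNF neqIK => KI; rewrite eqEsubset IK.
by rewrite ffunE setDv eqxx inversions0r addr0 mul1r mulr1.
Qed.

Lemma ext_mulDl : left_distributive ext_mul +%R.
Proof.
move=> a b c; apply/ffunP => K; rewrite !ffunE -big_split.
by apply: eq_bigr => I _; rewrite !ffunE mulrDl mulrDr.
Qed.

Lemma ext_mulDr : right_distributive ext_mul +%R.
Proof.
move=> a b c; apply/ffunP => K; rewrite !ffunE -big_split.
by apply: eq_bigr => I _; rewrite !ffunE !mulrDr.
Qed.

Lemma ext_one_neq0 : ext_one != 0 :> E.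
Proof. by apply/eqP => /ffunP/(_ set0)/eqP; rewrite !ffunE eqxx oner_eq0. Qed.

Lemma ext_scaleAl (c : R) a b : c *: ext_mul a b = ext_mul (c *: a) b.
Proof.
apply/ffunP => K; rewrite !ffunE scaler_sumr; apply: eq_bigr => I _.
rewrite ffunE /GRing.scale /= ; ring.
Qed.

Lemma ext_scaleAr (c : R) a b : c *: ext_mul a b = ext_mul a (c *: b).
Proof.
apply/ffunP => K; rewrite !ffunE scaler_sumr; apply: eq_bigr => I _.
rewrite ffunE /GRing.scale /=; ring.
Qed.

End ExteriorAlgebra.

HB.instance Definition _ (R : comNzRingType) m :=
  GRing.Zmodule_isNzRing.Build (exterior R m) (@ext_mulA R m)
    (@ext_mul1w R m) (@ext_mulw1 R m) (@ext_mulDl R m) (@ext_mulDr R m)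
    (@ext_one_neq0 R m).

HB.instance Definition _ (R : comNzRingType) m :=
  GRing.Lmodule_isLalgebra.Build R (exterior R m) (@ext_scaleAl R m).

HB.instance Definition _ (R : comNzRingType) m :=
  GRing.Lalgebra_isAlgebra.Build R (exterior R m) (@ext_scaleAr R m).

Section ExteriorPower.
Variables (R : comNzRingType) (m : nat).
Local Notation E := (exterior R m).
Implicit Types (I J K : {set 'I_m}) (i j : 'I_m) (w : E).
Implicit Types (u : 'cV[R]_m) (g : 'M[R]_m).

Definition xi i : E := [ffun K => (K == [set i])%:R].

Definition xiI I : E := \prod_(i in I) xi i.

Definition ext_vec u : E := \sum_j u j 0 *: xi j.

(* The linear map with u_0 ... u_(d-1) |-> (g u_0) ... (g u_(d-1)) on         *)
(* products of vectors, in every degree d at once; see ext_act_prod.          *)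
Definition ext_act g w : E :=
  \sum_(I : {set 'I_m}) w I *: \prod_(i in I) ext_vec (g *m delta_mx i 0).

(* The xiI I are orthonormal (ext_dot_xiI), so components of different        *)
(* degrees are orthogonal and this restricts to the inner product induced on  *)
(* each exterior power.                                                       *)
Definition ext_dot w w' : R := \sum_(I : {set 'I_m}) w I * w' I.

Let e J : E := [ffun K => (K == J)%:R].

Lemma xi_mulE i w K :
  (xi i * w) K = if i \in K then (-1) ^+ inversions [set i] (K :\ i) * w (K :\ i)
                 else 0.
Proof.
rewrite [LHS]ffunE; case: ifPn => iK.
  rewrite (bigD1 [set i]) ?sub1set //= big1 => [|I /andP[_ /negPf neqI]].
    by rewrite ffunE eqxx mul1r addr0.
  by rewrite ffunE neqI mul0r mulr0.
rewrite big1 // => I IK; rewrite ffunE (_ : (I == [set i]) = false) ?mul0r ?mulr0 //.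
by apply: contraNF iK => /eqP eI; rewrite -sub1set -eI.
Qed.

Lemma xi_mul_basis i J : xi i * e J =
  if i \in J then 0 else (-1) ^+ inversions [set i] J *: e (i |: J).
Proof.
apply/ffunP => K; rewrite xi_mulE !ffunE.
case: (boolP (i \in J)) => iJ.
  rewrite ffunE; case: ifP => // iK; rewrite (_ : (_ == _) = false) ?mulr0 //.
  by apply: contraTF iJ => /eqP <-; rewrite !inE eqxx.
rewrite !ffunE; case: ifPn => iK.
  have -> : (K == i |: J) = (K :\ i == J).
    by apply/eqP/eqP => [->|<-]; [rewrite setU1K | rewrite setD1K].
  by case: eqP => [->|_] //; rewrite ?mulr0 ?scaler0.
rewrite (_ : (_ == _) = false) ?scaler0 //.
by apply: contraNF iK => /eqP ->; rewrite !inE eqxx.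
Qed.

Lemma inversions1 i j : inversions [set i] [set j] = (j < i)%N.
Proof. by rewrite /inversions !big_set1. Qed.

Lemma xi_sqr i : xi i * xi i = 0.
Proof. by rewrite xi_mul_basis !inE eqxx. Qed.

Lemma xi_anticomm i j : xi i * xi j = - (xi j * xi i).
Proof.
have [->|neq_ij] := eqVneq i j; first by rewrite xi_sqr oppr0.
rewrite !xi_mul_basis !inE (negPf neq_ij) eq_sym (negPf neq_ij) !inversions1.
rewrite setUC -scaleNr; congr (_ *: _).
have : i != j :> nat by [].
by case: ltngtP => //; rewrite ?expr0 ?expr1 ?opprK.
Qed.

Lemma enum_sorted I : sorted ltn (map val (enum I)).
Proof.
rewrite -[enum _](eq_filter (mem_enum _)).
rewrite -(eq_filter (mem_map val_inj _)) -filter_map.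
by rewrite (sorted_filter ltn_trans) // -enumT val_enum_ord iota_ltn_sorted.
Qed.

Lemma prod_sorted (A : nzRingType) (v : 'I_m -> A) (s : seq 'I_m) :
    sorted ltn (map val s) ->
  \prod_(j in [set j in s]) v j = \prod_(j <- s) v j.
Proof.
move=> s_sorted; rewrite -big_filter deprecated_filter_index_enum.
congr (\big[_/_]_(j <- _) _); apply: (inj_map val_inj).
apply: (irr_sorted_eq ltn_trans ltnn); rewrite ?enum_sorted // => y.
by apply/mapP/mapP=> [] [x t_x ->]; exists x; rewrite // mem_enum inE in t_x *.
Qed.

Section Anticommuting.
Variables (A : nzRingType) (v : 'I_m -> A).
Hypothesis v_sqr : forall i, v i * v i = 0.
Hypothesis v_anticomm : forall i j, v i * v j = - (v j * v i).

Lemma mul_prod_mem i (s : seq 'I_m) : i \in s -> v i * \prod_(j <- s) v j = 0.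
Proof.
elim: s => // j s IHs; rewrite inE big_cons mulrA; case: eqVneq => [<- _|_ /= si].
  by rewrite v_sqr mul0r.
by rewrite v_anticomm mulNr -mulrA IHs // mulr0 oppr0.
Qed.

Lemma mul_prod_notin i (s : seq 'I_m) : sorted ltn (map val s) -> i \notin s ->
  exists t : seq 'I_m, [/\ sorted ltn (map val t), t =i i :: s &
    v i * \prod_(j <- s) v j
      = (-1) ^+ (\sum_(j <- s) (j < i)%N) * \prod_(j <- t) v j].
Proof.
elim: s => [_ _|j s IHs]; first by exists [:: i]; rewrite !big_nil mul1r big_seq1 mulr1.
rewrite /= (path_sortedE ltn_trans) inE negb_or => /andP[js s_sorted] /andP[neq_ij si].
have: i != j :> nat by []; case: ltngtP => // [lt_ij|lt_ji] _.
  exists (i :: j :: s); split => //=; first by rewrite lt_ij (path_sortedE ltn_trans) js.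
  suff -> : (\sum_(k <- j :: s) (k < i) = 0)%N by rewrite mul1r !big_cons.
  rewrite big_seq big1 // => k; rewrite inE.
  case/predU1P => [->|ks]; first by rewrite ltnNge ltnW.
  have /allP/(_ _ (map_f val ks)) /= lt_jk := js.
  by rewrite ltnNge ltnW // (ltn_trans lt_ij).
have [t [t_sorted t_s E_t]] := IHs s_sorted si.
exists (j :: t); split.
- rewrite /= (path_sortedE ltn_trans) t_sorted andbT.
  apply/allP => _ /mapP[k kt ->]; move: kt; rewrite t_s inE => /predU1P[-> //|ks].
  exact: (allP js) (map_f val ks).
- by move=> k; rewrite !inE t_s inE orbCA.
- rewrite !big_cons lt_ji; transitivity (- (v j * (v i * \prod_(k <- s) v k))).
    by rewrite mulrA v_anticomm mulNr mulrA.
  by rewrite E_t exprS mulN1r mulNr [v j * _]mulrA commr_sign mulrA.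
Qed.

Lemma mul_prod_set i J : v i * \prod_(j in J) v j =
  if i \in J then 0
  else (-1) ^+ inversions [set i] J * \prod_(j in i |: J) v j.
Proof.
have -> : \prod_(j in J) v j = \prod_(j <- enum J) v j.
  by rewrite -prod_sorted ?enum_sorted // set_enum.
case: ifPn => iJ; first by rewrite mul_prod_mem ?mem_enum.
have [|t [t_sorted t_J ->]] := mul_prod_notin (enum_sorted J) (i := i).
  by rewrite mem_enum.
rewrite -prod_sorted // /inversions big_set1 big_enum /=.
congr (_ * _); apply: eq_bigl => j.
by rewrite !inE t_J inE mem_enum.
Qed.
End Anticommuting.

Lemma xiIE I J : xiI I J = (J == I)%:R.
Proof.
suff -> : xiI I = e I by rewrite ffunE.
have [k le_Ik] := ubnP #|I|; elim: k I le_Ik => // k IHk I.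
have [->|[i iI]] := set_0Vmem I; first by rewrite /xiI big_set0.
rewrite (cardsD1 i) iI => /IHk IH.
have := mul_prod_set xi_sqr xi_anticomm i (I :\ i).
rewrite -/(xiI _) IH xi_mul_basis !inE eqxx /= setD1K // -/(xiI _).
rewrite -[X in X *: _]signr_odd -[X in _ = X * _]signr_odd.
case: odd; rewrite ?expr1 ?scaleN1r ?mulN1r ?scale1r ?mul1r //.
by move=> /eqP; rewrite eqr_opp => /eqP.
Qed.

Lemma ext_basisE w : w = \sum_(I : {set 'I_m}) w I *: xiI I.
Proof.
apply/ffunP => J; rewrite sum_ffunE (bigD1 J) //= big1 => [|I /negPf neqIJ].
  by rewrite ffunE xiIE eqxx addr0 [_ *: _]mulr1.
by rewrite ffunE xiIE eq_sym neqIJ scaler0.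
Qed.

Lemma ext_dot_xiI I J : ext_dot (xiI I) (xiI J) = (I == J)%:R.
Proof.
rewrite /ext_dot (bigD1 I) //= big1 => [|K /negPf neqKI].
  by rewrite !xiIE eqxx addr0 mul1r.
by rewrite xiIE neqKI mul0r.
Qed.

Fact ext_vec_is_linear : linear ext_vec.
Proof.
move=> c u u'; rewrite /ext_vec scaler_sumr -big_split; apply: eq_bigr => i _.
by rewrite !mxE scalerDl scalerA.
Qed.
HB.instance Definition _ :=
  GRing.isLinear.Build R 'cV[R]_m E *:%R ext_vec ext_vec_is_linear.

Fact ext_act_is_linear g : linear (ext_act g).
Proof.
move=> c w w'; rewrite /ext_act scaler_sumr -big_split; apply: eq_bigr => I _.
by rewrite !ffunE scalerDl scalerA.
Qed.
HB.instance Definition _ g :=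
  GRing.isLinear.Build R E E *:%R (ext_act g) (ext_act_is_linear g).

Lemma ext_vec_delta i : ext_vec (delta_mx i 0) = xi i.
Proof.
rewrite /ext_vec (bigD1 i) //= big1 => [|j /negPf neqji].
  by rewrite mxE !eqxx scale1r addr0.
by rewrite mxE neqji scale0r.
Qed.

Lemma ext_vec_anticomm u u' : ext_vec u * ext_vec u' = - (ext_vec u' * ext_vec u).
Proof.
rewrite /ext_vec !mulr_suml -sumrN.
under eq_bigr => i _ do rewrite mulr_sumr.
under [RHS]eq_bigr => i _ do rewrite mulr_sumr -sumrN.
rewrite exchange_big; apply: eq_bigr => i _; apply: eq_bigr => j _ /=.
by rewrite -!scalerAl -!scalerAr xi_anticomm !scalerN !scalerA mulrC.
Qed.

Lemma ext_vec_sqr u : ext_vec u * ext_vec u = 0.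
Proof.
pose U (s : seq 'I_m) : 'cV[R]_m := \sum_(i <- s) u i 0 *: delta_mx i 0.
have -> : u = U (index_enum _).
  apply/colP => j; rewrite summxE (bigD1 j) //= big1 => [|i /negPf neqij].
    by rewrite !mxE !eqxx addr0 mulr1.
  by rewrite !mxE eq_sym neqij mulr0.
elim: (index_enum _) => [|i s IHs]; first by rewrite /U big_nil linear0 mul0r.
have -> : U (i :: s) = u i 0 *: delta_mx i 0 + U s by rewrite /U big_cons.
rewrite linearD linearZ /= ext_vec_delta mulrDl !mulrDr IHs addr0.
rewrite -ext_vec_delta -scalerAl -scalerAr ext_vec_delta xi_sqr !scaler0 add0r.
by rewrite -ext_vec_delta -linearZ /= ext_vec_anticomm addNr.
Qed.

Lemma ext_act_xiI g I :
  ext_act g (xiI I) = \prod_(i in I) ext_vec (g *m delta_mx i 0).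
Proof.
rewrite /ext_act (bigD1 I) //= xiIE eqxx scale1r [X in _ + X]big1 ?addr0 //.
by move=> J /negPf neqJI; rewrite xiIE neqJI scale0r.
Qed.

Lemma ext_act_mul g u w :
  ext_act g (ext_vec u * w) = ext_vec (g *m u) * ext_act g w.
Proof.
have scale_sign k (w' : E) : (-1) ^+ k * w' = (-1) ^+ k *: w'.
  by rewrite -signr_odd -[in RHS]signr_odd; case: odd;
    rewrite ?scaleN1r ?mulN1r ?scale1r ?mul1r.
have act_xi i I :
    ext_act g (xi i * xiI I) = ext_vec (g *m delta_mx i 0) * ext_act g (xiI I).
  rewrite /xiI (mul_prod_set xi_sqr xi_anticomm) -!/(xiI _) !ext_act_xiI.
  rewrite (mul_prod_set (v := fun j => ext_vec (g *m delta_mx j 0))) //=.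
  - by case: ifP; rewrite ?linear0 // !scale_sign linearZ /= ext_act_xiI.
  - by move=> j; apply: ext_vec_sqr.
  - by move=> j k; apply: ext_vec_anticomm.
have -> : g *m u = \sum_i u i 0 *: (g *m delta_mx i 0).
  apply/colP => k; rewrite summxE mxE; apply: eq_bigr => i _.
  by rewrite -colE !mxE mulrC.
rewrite [w]ext_basisE [in RHS]linear_sum [in RHS]linear_sum /=.
rewrite {1}/ext_vec !mulr_suml linear_sum; apply: eq_bigr => i _ /=.
rewrite !mulr_sumr linear_sum; apply: eq_bigr => I _ /=.
by rewrite -!scalerAr -!scalerAl !linearZ /= act_xi -[in RHS]scalerAr -scalerAl.
Qed.

Lemma ext_act_prod g (us : seq 'cV[R]_m) :
  ext_act g (\prod_(u <- us) ext_vec u) = \prod_(u <- us) ext_vec (g *m u).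
Proof.
elim: us => [|u us IHus]; last by rewrite !big_cons ext_act_mul IHus.
by have := ext_act_xiI g set0; rewrite /xiI !big_set0 !big_nil.
Qed.

Lemma ext_prod_homog (us : seq 'cV[R]_m) K :
  #|K| != size us -> (\prod_(u <- us) ext_vec u) K = 0.
Proof.
elim: us K => [|u us IHus] K szK.
  by rewrite big_nil [LHS]ffunE; move: szK; rewrite cards_eq0 => /negPf->.
rewrite big_cons {1}/ext_vec mulr_suml sum_ffunE big1 // => i _.
rewrite -scalerAl ffunE xi_mulE; case: ifP => iK; rewrite ?scaler0 //.
rewrite IHus ?mulr0 ?scaler0 //; apply: contra szK => /eqP /= <-.
by rewrite (cardsD1 i K) iK.
Qed.

End ExteriorPower.

(* Elements of Z_2^(n+1) are functions 'I_n.+1 -> bool, coerced to {0, 1}.    *)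
Notation binvec n := {ffun 'I_n.+1 -> bool}.

Definition weight n (eps : binvec n) : nat := \sum_i eps i.

Definition xi_monomial (R : comNzRingType) n (eps : binvec n) :
  exterior R n.+1 := \prod_i xi R i ^+ eps i.

(* The coefficient of xi^eps, divided by d!, in the generating product;       *)
(* meaningful when weight eps = weight teps (see odd_krawtchouk_gen).         *)
Definition odd_krawtchouk (F : numFieldType) n (V : 'M[F]_n.+1)
    (eps teps : binvec n) : F :=
  (\prod_i (\sum_j V i j *: xi F j) ^+ teps i : exterior F n.+1)
     [set i | eps i] / (weight eps)`!%:R.

Lemma xi_monomialE (R : comNzRingType) n (eps : binvec n) :
  xi_monomial R eps = xiI R [set i | eps i].
Proof.
rewrite /xi_monomial /xiI [RHS]big_mkcond; apply: eq_bigr => i _.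
by rewrite inE; case: (eps i).
Qed.

Lemma weightE n (eps : binvec n) : weight eps = #|[set i | eps i]|.
Proof.
rewrite /weight -sum1_card [RHS]big_mkcond; apply: eq_bigr => i _.
by rewrite inE; case: (eps i).
Qed.

Lemma odd_krawtchouk_gen (F : numFieldType) n (V : 'M[F]_n.+1) (d : nat)
    (teps : binvec n) : weight teps = d ->
  \prod_i (\sum_j V i j *: xi F j) ^+ teps i =
  \sum_(eps : binvec n | weight eps == d)
     (d`!%:R * odd_krawtchouk V eps teps) *: xi_monomial F eps.
Proof.
move=> teps_d; set w := (LHS).
have w_homog (K : {set 'I_n.+1}) : #|K| != d -> w K = 0.
  move=> neqKd.
  have -> : w = \prod_(u <- [seq (row i V)^T | i <- enum [set i | teps i]]) ext_vec u.
    rewrite big_map -prod_sorted ?enum_sorted // set_enum [RHS]big_mkcond.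
    apply: eq_bigr => i _ /=; rewrite inE; case: (teps i) => //.
    by rewrite expr1; apply: eq_bigr => j _; rewrite !mxE.
  by apply: ext_prod_homog; rewrite size_map -cardE -weightE teps_d.
rewrite [w]ext_basisE (bigID (fun K : {set 'I_n.+1} => #|K| == d)) /=.
rewrite addrC big1 ?add0r => [|K /w_homog->]; last by rewrite scale0r.
rewrite (reindex (fun eps : binvec n => [set i | eps i])) /=; last first.
  exists (fun K : {set 'I_n.+1} => [ffun i => i \in K]) => [eps|K] _.
    by apply/ffunP => i; rewrite ffunE inE.
  by apply/setP => i; rewrite inE ffunE.
apply: eq_big => [eps|eps]; first by rewrite weightE.
rewrite -weightE => /eqP eps_d; rewrite xi_monomialE /odd_krawtchouk eps_d.
by rewrite mulrC divfK // pnatr_eq0 -lt0n fact_gt0.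
Qed.

Definition krawtchouk_parameters (F : fieldType) n (q qt : 'rV[F]_n.+1)
    (V : 'M[F]_n.+1) : Prop :=
  [/\ q 0 0 = qt 0 0 /\ q 0 0 != 0,
      forall j, V 0 j = 1,
      forall i, V i 0 = 1 &
      diag_mx q *m V *m diag_mx qt *m V^T = (q 0 0)%:M].

Definition SO (R : realType) (m : nat) : pred 'M[R]_m :=
  [pred g | (g *m g^T == 1%:M) && (\det g == 1)].
Arguments SO : clear implicits.

(* xi_0 ^ ... ^ xi_(d-1), for d <= n.+1                                       *)
Definition vK (R : realType) (n d : nat) : exterior R n.+1 :=
  \prod_(i < n.+1 | (i < d)%N) xi R i.

(* The spherical function of SO(n+1)/(SO(d) x SO(n+1-d)), extended by the     *)
(* same formula to all matrices.                                              *)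
Definition spherical (R : realType) (n d : nat) (g : 'M[R]_n.+1) : R :=
  ext_dot (vK R n d) (ext_act g (vK R n d)).

(* The matrix g_V, where s and st are the diagonals of the chosen square      *)
(* roots of diag_mx q and diag_mx qt, and q0 stands for q 0 0.                *)
Definition gV (R : realType) (n : nat) (q0 : R) (s st : 'rV[R]_n.+1)
    (V : 'M[R]_n.+1) : 'M[R]_n.+1 :=
  (Num.sqrt q0)^-1 *: (diag_mx s *m V *m diag_mx st).

Lemma gV_SO (R : realType) (n : nat) (q qt s st : 'rV[R]_n.+1)
    (V : 'M[R]_n.+1) :
    krawtchouk_parameters q qt V -> 0 < q 0 0 ->
    diag_mx s *m diag_mx s = diag_mx q ->
    diag_mx st *m diag_mx st = diag_mx qt ->
  \det (gV (q 0 0) s st V) = 1 -> gV (q 0 0) s st V \in SO R n.+1.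
Proof.
move=> [_ _ _ QV] q_gt0 s_q st_qt det1; rewrite !inE det1 eqxx andbT /gV.
set r := Num.sqrt _.
have r2 : r * r = q 0 0 by rewrite -expr2 sqr_sqrtr ?ltW.
have r_neq0 : r != 0 by rewrite sqrtr_eq0 -ltNge.
have SM : diag_mx s *m (diag_mx s *m (V *m diag_mx qt *m V^T)) = (q 0 0)%:M.
  by rewrite mulmxA s_q -QV !mulmxA.
have q_neq0 : q 0 0 != 0 by rewrite gt_eqF.
have MS : diag_mx s *m (V *m diag_mx qt *m V^T) *m diag_mx s = (q 0 0)%:M.
  have /mulmx1C : diag_mx s *m
      ((q 0 0)^-1 *: (diag_mx s *m (V *m diag_mx qt *m V^T))) = 1%:M.
    by rewrite -scalemxAr SM scale_scalar_mx mulVf.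
  rewrite -scalemxAl => /(congr1 ( *:%R (q 0 0))).
  by rewrite scalerA mulfV // scale1r scale_scalar_mx mulr1.
rewrite linearZ /= -scalemxAl -scalemxAr scalerA !trmx_mul !tr_diag_mx.
have -> : diag_mx s *m V *m diag_mx st *m (diag_mx st *m (V^T *m diag_mx s))
    = diag_mx s *m (V *m diag_mx qt *m V^T) *m diag_mx s.
  by rewrite -st_qt !mulmxA.
by rewrite MS scale_scalar_mx -invfM r2 mulVf.
Qed.

(* Main.v *)
Require Import Defs.
From HB Require Import structures.
From mathcomp Require Import all_boot all_order all_algebra.
From mathcomp Require Import ring.
From mathcomp Require Import reals.

Set Implicit Arguments.
Unset Strict Implicit.
Unset Printing Implicit Defensive.

Import Order.TTheory GRing.Theory Num.Theory.
Local Open Scope ring_scope.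

(** Both sides are the same minor. With [I] and [J] the supports of [teps] and
    [eps], the left-hand side times [d!] is the coefficient of [xiI J] in the
    product over [i] in [I] of the [i]-th rows of [V], that is, of
    [ext_act V^T (xiI I)]. On the right-hand side only the term of this pair
    [(I, J)] survives, because the indices range over sets with as many elements
    as the supports; as [sigma I] is orthogonal and maps the vector [vK] to
    [xiI I], and likewise for [J], the spherical function there is the matrix
    coefficient [ext_dot (xiI I) (ext_act gV (xiI J))]. Moving [gV] across the
    inner product turns it into the coefficient of [xiI J] in
    [ext_act gV^T (xiI I)], and the two diagonal factors of
    [gV^T = q0^(-1/2) st V^T s] act on monomials by scalars, which the prefactors
    cancel.

    The one substantial ingredient is that [ext_act g^T] is the adjoint of
    [ext_act g] ([ext_dot_act]). Instead of comparing expansions of minors along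
    rows and along columns, the proof uses contractions: contraction by [u] is
    the adjoint of left multiplication by [u] ([ext_dot_mul_vec]), it
    satisfies the Clifford relation with multiplications ([ext_contract_mul]),
    and hence it intertwines with [ext_act] ([ext_contract_act]). The adjunction
    then follows by multiplying one generator at a time. *)

(** * Contractions and the adjoint of the exterior action *)

Section ExteriorAdjoint.
Variables (R : comNzRingType) (m : nat).
Local Notation E := (exterior R m).
Implicit Types (I K : {set 'I_m}) (i j : 'I_m) (w : E).
Implicit Types (u v : 'cV[R]_m) (g h : 'M[R]_m).

Lemma ext_coefZ c w I : (c *: w) I = c * w I.
Proof. by rewrite ffunE. Qed.

Lemma ext_ind (P : E -> Prop) : P 1 ->
    (forall w w', P w -> P w' -> P (w + w')) ->
    (forall c w, P w -> P (c *: w)) ->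
    (forall i w, P w -> P (xi R i * w)) ->
  forall w, P w.
Proof.
move=> P1 PD PZ PM w; rewrite [w]ext_basisE.
have P0 : P 0 by rewrite -(scale0r (1 : E)); apply: PZ.
apply: (big_ind P) => // I _; apply: PZ; rewrite /xiI.
by apply: (big_rec P) => // i w' _; apply: PM.
Qed.

Lemma ext_act1 g : ext_act g 1 = 1.
Proof. by have := ext_act_prod g [::]; rewrite !big_nil. Qed.

Lemma ext_actM g h w : ext_act (g *m h) w = ext_act g (ext_act h w).
Proof.
move: w; apply: ext_ind => [|w w' IHw IHw'|c w IHw|i w IHw].
- by rewrite !ext_act1.
- by rewrite !linearD /= IHw IHw'.
- by rewrite !linearZ /= IHw.
- by rewrite -ext_vec_delta !ext_act_mul IHw mulmxA.
Qed.

Lemma ext_act_set0 g w : ext_act g w set0 = w set0.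
Proof.
move: w; apply: ext_ind => [|w w' IHw IHw'|c w IHw|i w IHw].
- by rewrite ext_act1.
- by rewrite linearD !ffunE IHw IHw'.
- by rewrite linearZ !ffunE IHw.
- rewrite -ext_vec_delta ext_act_mul {1 2}/ext_vec !mulr_suml !sum_ffunE.
  by apply: eq_bigr => j _; rewrite -!scalerAl !ext_coefZ !xi_mulE !inE !mulr0.
Qed.

Lemma ext_dotC w w' : ext_dot w w' = ext_dot w' w.
Proof. by apply: eq_bigr => I _; rewrite mulrC. Qed.

Lemma ext_dotDl w1 w2 w : ext_dot (w1 + w2) w = ext_dot w1 w + ext_dot w2 w.
Proof.
by rewrite /ext_dot -big_split; apply: eq_bigr => I _; rewrite ffunE mulrDl.
Qed.

Lemma ext_dotZl c w w' : ext_dot (c *: w) w' = c * ext_dot w w'.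
Proof.
by rewrite /ext_dot mulr_sumr; apply: eq_bigr => I _; rewrite ffunE -mulrA.
Qed.

Lemma ext_dot_suml (A : Type) (r : seq A) (F : A -> E) w :
  ext_dot (\sum_(a <- r) F a) w = \sum_(a <- r) ext_dot (F a) w.
Proof.
elim: r => [|a r IHr]; last by rewrite !big_cons ext_dotDl IHr.
by rewrite !big_nil -(scale0r 0) ext_dotZl mul0r.
Qed.

Lemma ext_dot_xiIl I w : ext_dot (xiI R I) w = w I.
Proof.
rewrite /ext_dot (bigD1 I) //= big1 => [|K /negPf neqKI].
  by rewrite xiIE eqxx mul1r addr0.
by rewrite xiIE neqKI mul0r.
Qed.

(** The left derivative with respect to the anticommuting variable [xi i]. *)
Definition ext_deriv i w : E :=
  [ffun K : {set 'I_m} => if i \in K then 0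
             else (-1) ^+ inversions [set i] K * w (i |: K)].

Fact ext_deriv_is_linear i : linear (ext_deriv i).
Proof.
move=> c w w'; apply/ffunP => K; rewrite !ffunE.
case: ifP => _; first by rewrite scaler0 addr0.
by rewrite /GRing.scale /= mulrDr mulrCA.
Qed.
HB.instance Definition _ i :=
  GRing.isLinear.Build R E E *:%R (ext_deriv i) (ext_deriv_is_linear i).

Lemma ext_deriv1 i : ext_deriv i 1 = 0.
Proof.
apply/ffunP => K; rewrite !ffunE; case: ifP => // _.
rewrite (_ : (_ == _) = false) ?mulr0 //; apply/negP => /eqP/setP/(_ i).
by rewrite !inE eqxx.
Qed.

Lemma ext_dot_mul_xi i w w' : ext_dot (xi R i * w) w' = ext_dot w (ext_deriv i w').
Proof.
rewrite /ext_dot (bigID (fun K : {set 'I_m} => i \in K)) /= [X in _ + X]big1 ?addr0.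
  rewrite [RHS](bigID (fun K : {set 'I_m} => i \notin K)) /= [X in _ = _ + X]big1.
    rewrite addr0 (reindex_onto (fun K : {set 'I_m} => i |: K)
      (fun K : {set 'I_m} => K :\ i)) /=.
      apply: eq_big => [K|K /andP[_ /eqP eK]]; last first.
        have iK : i \notin K by rewrite -eK !inE eqxx.
        by rewrite xi_mulE ffunE setU11 (negPf iK) setU1K // mulrAC mulrC.
      rewrite setU11 /=; apply/eqP/idP => [<-|]; last by move/setU1K.
      by rewrite !inE eqxx.
    by move=> K iK; rewrite setD1K.
  by move=> K /negPn iK; rewrite ffunE iK mulr0.
by move=> K /negPf iK; rewrite xi_mulE iK mul0r.
Qed.

(** For [i != j] the sign on the right-hand side arises because exactly one of
    [i < j] and [j < i] holds: one of the two orders of the operators creates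
    an additional inversion. *)
Lemma ext_deriv_mul i j w :
  ext_deriv i (xi R j * w) = (i == j)%:R *: w - xi R j * ext_deriv i w.
Proof.
apply/ffunP => K; rewrite ffunE xi_mulE [RHS]ffunE [X in X + _]ffunE.
rewrite [X in _ + X]ffunE xi_mulE !ffunE.
have [<-|neq_ij] := eqVneq i j.
  rewrite !inE eqxx /= [_ *: _]mul1r; case: ifPn => iK.
    by rewrite setD1K // mulrA -signr_odd -signr_addb addbb mul1r subrr.
  by rewrite setU1K // mulrA -signr_odd -signr_addb addbb mul1r subr0.
rewrite [_ *: _]mul0r add0r !inE eq_sym (negPf neq_ij) /=.
have [iK|iK] := boolP (i \in K); first by rewrite mulr0 if_same oppr0.
case: ifP => [jK|_]; last by rewrite mulr0 oppr0.
have iKj : i \notin K :\ j by rewrite !inE (negPf iK) andbF.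
have -> : (i |: K) :\ j = i |: (K :\ j).
  apply/setP => k; rewrite !inE; have [->|_] := eqVneq k i => //=.
  by rewrite neq_ij.
have inv_i : inversions [set i] K = ((j < i) + inversions [set i] (K :\ j))%N.
  rewrite -{1}(setD1K jK) inversionsUr ?inversions1 //.
  by rewrite disjoints1 !inE eqxx.
have inv_j : inversions [set j] (i |: K :\ j)
    = ((i < j) + inversions [set j] (K :\ j))%N.
  by rewrite inversionsUr ?inversions1 // disjoints1.
rewrite inv_i inv_j !exprD -mulNr !mulrA; congr (_ * _).
have : i != j :> nat by [].
case: ltngtP => // _ _; rewrite ?expr0 ?expr1 ?mul1r ?mulr1 ?mulN1r ?mulrN1 ?mulNr;
  by rewrite mulrC.
Qed.

(** The contraction by [u], with column vectors identified with covectors by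
    the standard inner product. *)
Definition ext_contract u w : E := \sum_i u i 0 *: ext_deriv i w.

Fact ext_contract_is_linear u : linear (ext_contract u).
Proof.
move=> c w w'; rewrite /ext_contract scaler_sumr -big_split.
by apply: eq_bigr => i _; rewrite linearP scalerDr !scalerA mulrC.
Qed.
HB.instance Definition _ u :=
  GRing.isLinear.Build R E E *:%R (ext_contract u) (ext_contract_is_linear u).

Lemma ext_contract1 u : ext_contract u 1 = 0.
Proof. by apply: big1 => i _; rewrite ext_deriv1 scaler0. Qed.

Lemma ext_dot_mul_vec u w w' :
  ext_dot (ext_vec u * w) w' = ext_dot w (ext_contract u w').
Proof.
rewrite /ext_vec mulr_suml ext_dot_suml ext_dotC ext_dot_suml.
by apply: eq_bigr => i _; rewrite -scalerAl !ext_dotZl ext_dot_mul_xi ext_dotC.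
Qed.

Lemma ext_contract_mul u v w :
  ext_contract u (ext_vec v * w) = (u^T *m v) 0 0 *: w - ext_vec v * ext_contract u w.
Proof.
rewrite mxE scaler_suml /ext_contract mulr_sumr -sumrB; apply: eq_bigr => i _.
rewrite mxE -scalerAr -scalerA -scalerBr; congr (_ *: _).
rewrite /ext_vec !mulr_suml linear_sum /=.
have -> : v i 0 *: w = \sum_j v j 0 *: ((i == j)%:R *: w).
  rewrite (bigD1 i) //= eqxx scale1r big1 ?addr0 // => j /negPf neqji.
  by rewrite eq_sym neqji scale0r scaler0.
rewrite -sumrB; apply: eq_bigr => j _.
by rewrite -!scalerAl linearZ /= ext_deriv_mul scalerBr.
Qed.

(** Both sides, as functions of [w], kill [1] and obey the same Clifford
    relation with the multiplications by [h *m delta_mx i 0], since the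
    standard pairing of [u] with [h *m v] is that of [h^T *m u] with [v]. *)
Lemma ext_contract_act u h w :
  ext_contract u (ext_act h w) = ext_act h (ext_contract (h^T *m u) w).
Proof.
move: w; apply: ext_ind => [|w w' IHw IHw'|c w IHw|i w IHw].
- by rewrite ext_act1 !ext_contract1 linear0.
- by rewrite !linearD /= IHw IHw'.
- by rewrite !linearZ /= IHw.
- rewrite -ext_vec_delta ext_act_mul !ext_contract_mul linearB linearZ /=.
  by rewrite ext_act_mul IHw trmx_mul trmxK mulmxA.
Qed.

(** By induction on [w]: for a product [xi i * w], the factor
    [g *m delta_mx i 0] moves to the other side as a contraction, and
    [ext_contract_act] takes this contraction past [ext_act g^T]. *)
Lemma ext_dot_act g w w' :
  ext_dot (ext_act g w) w' = ext_dot w (ext_act g^T w').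
Proof.
move: w w'; apply: ext_ind => [w'|w1 w2 IH1 IH2 w'|c w IHw w'|i w IHw w'].
- have dot1 w : ext_dot 1 w = w set0.
    by rewrite -ext_dot_xiIl /xiI big_set0.
  by rewrite ext_act1 !dot1 ext_act_set0.
- by rewrite linearD !ext_dotDl IH1 IH2.
- by rewrite linearZ !ext_dotZl IHw.
- rewrite -ext_vec_delta ext_act_mul !ext_dot_mul_vec IHw ext_contract_act.
  by rewrite trmxK.
Qed.

Lemma ext_act_tr_coef g I K : ext_act g^T (xiI R I) K = ext_act g (xiI R K) I.
Proof. by rewrite -!ext_dot_xiIl -ext_dot_act ext_dotC. Qed.

Lemma ext_act_scale c g I :
  ext_act (c *: g) (xiI R I) = c ^+ #|I| *: ext_act g (xiI R I).
Proof.
rewrite !ext_act_xiI -prodr_const -scaler_prod; apply: eq_bigr => i _.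
by rewrite -scalemxAl linearZ.
Qed.

Lemma ext_act_diag (t : 'rV[R]_m) I :
  ext_act (diag_mx t) (xiI R I) = (\prod_(i in I) t 0 i) *: xiI R I.
Proof.
rewrite ext_act_xiI -scaler_prod; apply: eq_bigr => i _.
rewrite -ext_vec_delta -linearZ; congr (ext_vec _); apply/colP => k.
by rewrite mul_diag_mx !mxE; case: eqP => [->|]; rewrite ?mulr0.
Qed.

(** Transposition lets both diagonal factors act first, on monomials: the right
    one on [xiI K], and the left one, after passing to the adjoint, on
    [xiI I]. *)
Lemma ext_act_diag_coef (s t : 'rV[R]_m) g I K :
  ext_act (diag_mx s *m g *m diag_mx t) (xiI R K) I =
    (\prod_(i in I) s 0 i) * (\prod_(j in K) t 0 j) * ext_act g (xiI R K) I.
Proof.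
rewrite ext_actM ext_act_diag linearZ ffunE /= -ext_act_tr_coef.
rewrite trmx_mul tr_diag_mx ext_actM ext_act_diag linearZ ffunE /= ext_act_tr_coef.
by rewrite /GRing.scale /= mulrCA mulrA.
Qed.

End ExteriorAdjoint.

(** * The Krawtchouk polynomials as matrix coefficients *)

Theorem mainTheorem5 (R : realType) (n : nat)
    (q qt : 'rV[R]_n.+1) (V : 'M[R]_n.+1)
    (Lambda : krawtchouk_parameters q qt V)
    (q_gt0 : forall i, 0 < q 0 i) (qt_gt0 : forall i, 0 < qt 0 i)
    (s st : 'rV[R]_n.+1)
    (s_sqrt : diag_mx s *m diag_mx s = diag_mx q)
    (st_sqrt : diag_mx st *m diag_mx st = diag_mx qt)
    (det_gV : \det (gV (q 0 0) s st V) = 1)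
    (d : nat) (le_d : (d <= n.+1)%N)
    (sigma : {set 'I_n.+1} -> 'M[R]_n.+1)
    (sigmaP : forall I : {set 'I_n.+1}, #|I| = d ->
       sigma I \in SO R n.+1 /\ ext_act (sigma I) (vK R n d) = xiI R I)
    (eps teps : binvec n) (eps_d : weight eps = d) (teps_d : weight teps = d) :
  odd_krawtchouk V eps teps =
    Num.sqrt (q 0 0) ^+ d / d`!%:R *
    \sum_(I : {set 'I_n.+1} | #|I| == d) \sum_(J : {set 'I_n.+1} | #|J| == d)
      (\prod_(i in I) (s 0 i)^-1) * (\prod_(j in J) (st 0 j)^-1) *
      spherical d (invmx (sigma I) *m gV (q 0 0) s st V *m sigma J) *
      (\prod_(i in I) (teps i)%:R) * (\prod_(j in J) (eps j)%:R).
Proof.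
set I0 := [set i | teps i]; set J0 := [set j | eps j].
have cI0 : #|I0| = d by rewrite -weightE.
have cJ0 : #|J0| = d by rewrite -weightE.
(* A set of d elements contained in the support of e is the whole support. *)
have supp (e : binvec n) (I : {set 'I_n.+1}) : #|I| == d -> weight e = d ->
    \prod_(i in I) (e i)%:R = (I == [set i | e i])%:R :> R.
  move=> /eqP cI e_d; have [->|neqI] := eqVneq.
    by rewrite big1 // => i; rewrite inE => ->.
  have /subsetPn[i iI] : ~~ (I \subset [set i | e i]).
    apply: contra neqI => sI; rewrite eqEcard sI /= cI -weightE e_d //.
  by rewrite inE => /negPf ei; rewrite (bigD1 i) //= ei mul0r.
have spher : spherical d (invmx (sigma I0) *m gV (q 0 0) s st V *m sigma J0)
    = ext_act (gV (q 0 0) s st V) (xiI R J0) I0.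
  have [/andP[/eqP orthI _] actI] := sigmaP I0 cI0.
  have [_ actJ] := sigmaP J0 cJ0.
  have -> : invmx (sigma I0) = (sigma I0)^T.
    have [u _] := mulmx1_unit orthI.
    by rewrite -[LHS]mulmx1 -orthI mulKmx.
  by rewrite /spherical !ext_actM -ext_dot_act actI actJ ext_dot_xiIl.
rewrite (bigD1 I0) ?cI0 //= [X in _ + X]big1 => [|I /andP[cI neqI]]; last first.
  apply: big1 => J _.
  by rewrite (supp teps) // (negPf neqI) mulr0 mul0r.
rewrite (bigD1 J0) ?cJ0 //= [X in _ + X + _]big1 => [|J /andP[cJ neqJ]]; last first.
  by rewrite (supp eps) // (negPf neqJ) mulr0.
rewrite !addr0 !supp ?cI0 ?cJ0 // !eqxx !mulr1 spher.
have -> : odd_krawtchouk V eps teps = ext_act V (xiI R J0) I0 / d`!%:R.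
  rewrite /odd_krawtchouk eps_d; congr (_ / _).
  rewrite -ext_act_tr_coef ext_act_xiI [in RHS]big_mkcond.
  congr ((_ : exterior R n.+1) _); apply: eq_bigr => i _.
  rewrite inE; case: (teps i) => //; rewrite expr1 /ext_vec.
  by apply: eq_bigr => j _; rewrite -colE !mxE.
have sqrt_neq0 (t p : 'rV[R]_n.+1) i : (forall i, 0 < p 0 i) ->
    diag_mx t *m diag_mx t = diag_mx p -> t 0 i != 0.
  move=> /(_ i) p_gt0 /matrixP/(_ i i); rewrite mul_diag_mx !mxE eqxx !mulr1n.
  by apply: contra_eq_neq => ->; rewrite mul0r lt_eqF.
rewrite /gV ext_act_scale cJ0 ext_coefZ ext_act_diag_coef.
have r_neq0 : Num.sqrt (q 0 0) ^+ d != 0 by rewrite expf_neq0 // sqrtr_eq0 -ltNge.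
have s_neq0 : \prod_(i in I0) s 0 i != 0.
  by apply/prodf_neq0 => i _; apply: sqrt_neq0 s_sqrt.
have st_neq0 : \prod_(j in J0) st 0 j != 0.
  by apply/prodf_neq0 => j _; apply: sqrt_neq0 st_sqrt.
rewrite !prodfV exprVn.
by field; rewrite r_neq0 s_neq0 st_neq0 pnatr_eq0 -lt0n fact_gt0.
Qed.
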